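(* Let $\mathscr{C}$ be a ($\Bbbk$-linear, $\Bbbk$ a field) left closed monoidal category such that every lax left $\mathscr{C}$-module endofunctor of $\mathscr{C}$ is strong; in other words, such that the monoidal embedding $$\mathsf{Str}\mathscr{C}\mathsf{Mod}(\mathscr{C},\mathscr{C})\hookrightarrow\mathsf{Lax}\mathscr{C}\mathsf{Mod}(\mathscr{C},\mathscr{C})$$ is an equivalence. Then $\mathscr{C}$ is left rigid.
   Context: $\mathscr{C}$ is a left module category over itself via $\otimes$. A lax $\mathscr{C}$-module endofunctor $F$ of $\mathscr{C}$ has natural coherent maps $x\otimes Fy\to F(x\otimes y)$; it is strong if these maps are invertible. $\mathsf{Str}\mathscr{C}\mathsf{Mod}(\mathscr{C},\mathscr{C})$ and $\mathsf{Lax}\mathscr{C}\mathsf{Mod}(\mathscr{C},\mathscr{C})$ denote the categories of strong, respectively lax, $\mathscr{C}$-module endofunctors and $\mathscr{C}$-module transformations, monoidal under composition. Left closed means that for every $x\in\mathscr{C}$ the functor $-\otimes x$ has a right adjoint. Left rigid means every object $x$ has a left dual ${}^\vee x$, with ${}^\vee x\otimes x\to1$ and $1\to x\otimes{}^\vee x$ satisfying the snake identities. All categories and functors are $\Bbbk$-linear. *)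

(* Defs.v *)
From mathcomp Require Import all_boot all_algebra.

Set Implicit Arguments.
Unset Strict Implicit.
Unset Printing Implicit Defensive.

Import GRing.Theory.
Local Open Scope ring_scope.

Declare Scope cat_scope.
Delimit Scope cat_scope with cat.
Local Open Scope cat_scope.

Record linCat (k : fieldType) := LinCat {
  obj :> Type;
  hom : obj -> obj -> lmodType k;
  idm : forall x, hom x x;
  comp : forall x y z, hom y z -> hom x y -> hom x z;
  comp1m : forall x y (f : hom x y), comp (idm y) f = f;
  compm1 : forall x y (f : hom x y), comp f (idm x) = f;
  compA : forall x y z t (h : hom z t) (g : hom y z) (f : hom x y),
    comp h (comp g f) = comp (comp h g) f;
  comp_linearl : forall x y z (f : hom x y), linear (fun g : hom y z => comp g f);
  comp_linearr : forall x y z (g : hom y z), linear (fun f : hom x y => comp g f)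
}.

Arguments hom {k C} x y : rename.
Arguments idm {k C} x : rename.
Arguments comp {k C x y z} g f : rename.

Notation "g \oc f" := (comp g f) (at level 50, left associativity) : cat_scope.

Section Isomorphisms.
Variables (k : fieldType) (C : linCat k).

Record iso (x y : C) := Iso {
  iso_hom :> hom x y;
  iso_inv : hom y x;
  iso_homK : iso_inv \oc iso_hom = idm x;
  iso_invK : iso_hom \oc iso_inv = idm y
}.

Definition is_iso (x y : C) (f : hom x y) : Prop :=
  exists g : hom y x, g \oc f = idm x /\ f \oc g = idm y.

End Isomorphisms.

Record linFunctor (k : fieldType) (C D : linCat k) := LinFunctor {
  fobj :> C -> D;
  fmap : forall x y : C, hom x y -> hom (fobj x) (fobj y);
  fmap1 : forall x, fmap (idm x) = idm (fobj x);
  fmapM : forall x y z (g : hom y z) (f : hom x y),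
    fmap (g \oc f) = fmap g \oc fmap f;
  fmap_linear : forall x y, linear (@fmap x y)
}.

Arguments fmap {k C D} F {x y} f : rename.

(* Unit-counit form of an adjunction F -| G. *)
Definition has_right_adjoint (k : fieldType) (C D : linCat k)
    (F : linFunctor C D) : Prop :=
  exists (G : linFunctor D C)
         (eta : forall x : C, hom x (G (F x)))
         (eps : forall y : D, hom (F (G y)) y),
  [/\ forall x x' (f : hom x x'), fmap G (fmap F f) \oc eta x = eta x' \oc f,
      forall y y' (g : hom y y'), g \oc eps y = eps y' \oc fmap F (fmap G g),
      forall x, eps (F x) \oc fmap F (eta x) = idm (F x)
    & forall y, fmap G (eps y) \oc eta (G y) = idm (G y)].

Record monCat (k : fieldType) := MonCat {
  mcat :> linCat k;
  one : mcat;
  tens : mcat -> mcat -> mcat;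
  tensm : forall x x' y y' : mcat,
    hom x x' -> hom y y' -> hom (tens x y) (tens x' y');
  tensm1 : forall x y, tensm (idm x) (idm y) = idm (tens x y);
  tensmM : forall x x' x'' y y' y''
      (f' : hom x' x'') (f : hom x x') (g' : hom y' y'') (g : hom y y'),
    tensm (f' \oc f) (g' \oc g) = tensm f' g' \oc tensm f g;
  tensm_linearl : forall x x' y y' (g : hom y y'),
    linear (fun f : hom x x' => tensm f g);
  tensm_linearr : forall x x' y y' (f : hom x x'),
    linear (fun g : hom y y' => tensm f g);
  assoc : forall x y z, iso (tens (tens x y) z) (tens x (tens y z));
  lunit : forall x, iso (tens one x) x;
  runit : forall x, iso (tens x one) x;
  assoc_nat : forall x x' y y' z z' (f : hom x x') (g : hom y y') (h : hom z z'),
    tensm f (tensm g h) \oc assoc x y z = assoc x' y' z' \oc tensm (tensm f g) h;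
  lunit_nat : forall x x' (f : hom x x'),
    f \oc lunit x = lunit x' \oc tensm (idm one) f;
  runit_nat : forall x x' (f : hom x x'),
    f \oc runit x = runit x' \oc tensm f (idm one);
  triangle : forall x y,
    tensm (idm x) (lunit y) \oc assoc x one y = tensm (runit x) (idm y);
  pentagon : forall x y z t,
    assoc x y (tens z t) \oc assoc (tens x y) z t =
    tensm (idm x) (assoc y z t) \oc assoc x (tens y z) t
      \oc tensm (assoc x y z) (idm t)
}.

Arguments one {k C} : rename.
Arguments tens {k C} x y : rename.
Arguments tensm {k C x x' y y'} f g : rename.
Arguments assoc {k C} x y z : rename.
Arguments lunit {k C} x : rename.
Arguments runit {k C} x : rename.

Notation "x \ot y" := (tens x y) (at level 40, left associativity) : cat_scope.
Notation "f \otm g" := (tensm f g) (at level 40, left associativity) : cat_scope.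

Section Monoidal.
Variables (k : fieldType) (C : monCat k).

Section TensorRight.
Variable x : C.

Fact tensr_fmap1 (y : C) : idm y \otm idm x = idm (y \ot x).
Proof. exact: tensm1. Qed.

Fact tensr_fmapM (y z t : C) (g : hom z t) (f : hom y z) :
  (g \oc f) \otm idm x = (g \otm idm x) \oc (f \otm idm x).
Proof. by rewrite -tensmM comp1m. Qed.

Definition tensr : linFunctor C C :=
  @LinFunctor k C C (fun y => y \ot x) (fun _ _ f => f \otm idm x)
    tensr_fmap1 tensr_fmapM (fun _ _ => tensm_linearl (idm x)).

End TensorRight.

Definition left_closed : Prop := forall x : C, has_right_adjoint (tensr x).

Definition is_left_dual (x xd : C) (ev : hom (xd \ot x) one)
    (coev : hom one (x \ot xd)) : Prop :=
     runit x \oc (idm x \otm ev) \oc assoc x xd x \oc (coev \otm idm x)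
       \oc iso_inv (lunit x) = idm x
  /\ lunit xd \oc (ev \otm idm xd) \oc iso_inv (assoc xd x xd)
       \oc (idm xd \otm coev) \oc iso_inv (runit xd) = idm xd.

Definition left_rigid : Prop :=
  forall x : C, exists (xd : C) (ev : hom (xd \ot x) one)
    (coev : hom one (x \ot xd)), is_left_dual ev coev.

(* Lax C-module endofunctors of C, seen as a left C-module category via \ot. *)
Record laxModFunctor := LaxModFunctor {
  lfun :> linFunctor C C;
  lact : forall x y : C, hom (x \ot lfun y) (lfun (x \ot y));
  lact_nat : forall x x' y y' (f : hom x x') (g : hom y y'),
    fmap lfun (f \otm g) \oc lact x y = lact x' y' \oc (f \otm fmap lfun g);
  lact_assoc : forall x y z,
    fmap lfun (assoc x y z) \oc lact (x \ot y) z =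
    lact x (y \ot z) \oc (idm x \otm lact y z) \oc assoc x y (lfun z);
  lact_unit : forall y, fmap lfun (lunit y) \oc lact one y = lunit (lfun y)
}.

Definition is_strong (F : laxModFunctor) : Prop :=
  forall x y, is_iso (lact F x y).

Record modTrans (F G : laxModFunctor) := ModTrans {
  mtrans :> forall x : C, hom (F x) (G x);
  mtrans_nat : forall x y (f : hom x y),
    fmap G f \oc mtrans x = mtrans y \oc fmap F f;
  mtrans_act : forall x y,
    mtrans (x \ot y) \oc lact F x y = lact G x y \oc (idm x \otm mtrans y)
}.

Definition modIso (F G : laxModFunctor) : Prop :=
  exists (s : modTrans F G) (t : modTrans G F),
    forall x, t x \oc s x = idm (F x) /\ s x \oc t x = idm (G x).

(* Strong module endofunctors form a full subcategory of the lax ones, so the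
   embedding is an equivalence iff it is essentially surjective. *)
Lemma lax_strong_iff_ess_surj :
  (forall F : laxModFunctor, is_strong F) <->
  (forall F : laxModFunctor, exists2 G : laxModFunctor, is_strong G & modIso F G).
Proof.
split=> [strongF F | essF F x y].
  exists F; first exact: strongF.
  have nat1 x y (f : hom x y) : fmap F f \oc idm (F x) = idm (F y) \oc fmap F f.
    by rewrite compm1 comp1m.
  have act1 x y : idm (F (x \ot y)) \oc lact F x y
                  = lact F x y \oc (idm x \otm idm (F y)).
    by rewrite tensm1 compm1 comp1m.
  by exists (ModTrans nat1 act1), (ModTrans nat1 act1) => x; rewrite /= comp1m.
have [G /(_ x y)[h [hK Kh]] [s [t st]]] := essF F.
have [ts1 st1] := st (x \ot y); have [ts2 st2] := st y.
have tK : (idm x \otm t y) \oc (idm x \otm s y) = idm (x \ot F y).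
  by rewrite -tensmM comp1m ts2 tensm1.
have sK : (idm x \otm s y) \oc (idm x \otm t y) = idm (x \ot G y).
  by rewrite -tensmM comp1m st2 tensm1.
have FE : lact F x y = t (x \ot y) \oc lact G x y \oc (idm x \otm s y).
  by rewrite -compA -mtrans_act compA ts1 comp1m.
exists ((idm x \otm t y) \oc h \oc s (x \ot y)); split; rewrite FE.
  rewrite -!compA (compA (s (x \ot y))) st1 comp1m (compA h) hK comp1m.
  exact: tK.
rewrite -!compA (compA (idm x \otm s y)) sK comp1m (compA (lact G x y)) Kh comp1m.
exact: ts1.
Qed.

End Monoidal.

(* Main.v *)
From mathcomp Require Import all_boot all_algebra.
Require Import Defs.

Set Implicit Arguments.
Unset Strict Implicit.
Unset Printing Implicit Defensive.

Local Open Scope cat_scope.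

(** Let [G] be the right adjoint of [- \ot x0], with counit [eps].  It is the
    internal hom out of [x0], and the mates of the maps
      [(idm x \otm eps y) \oc assoc x (G y) x0 :
         (x \ot G y) \ot x0 -> x \ot y]
    turn it into a lax module endofunctor.  If [G] is strong, then
    [x \ot G one] is isomorphic to [G (x \ot one)], hence to [G x]: the internal
    hom is computed by tensoring with [G one], which is the characteristic
    property of a dual of [x0].  Concretely, the dual is [G one] with evaluation
    [eps one], and the coevaluation [one -> x0 \ot G one] corresponds under
    [x0 \ot G one ~ G (x0 \ot one)] to the mate of the coherence isomorphism
    [one \ot x0 ~ x0 \ot one].

    The snake identity for [x0] amounts to the choice of that mate
    ([internal_hom_left_dual]).  The snake identity for [G one] is an equation
    between morphisms into an internal hom, so it may be checked on mates
    ([mate_inj]), where it follows from the first one ([ev_snake]).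

    The argument uses three classical consequences of the triangle and
    pentagon identities ([lunit_tens], [runit_tens], [lunit_one]). *)

(** * Composition and invertible morphisms *)

Section Linear.
Variables (k : fieldType) (C : linCat k).

(** Allows a known composite to be rewritten at the right end of a
    left-associated chain. *)
Lemma comp_at_end (x y z t : C) (g : hom y z) (f : hom x y) (h : hom x z)
    (e : g \oc f = h) (p : hom z t) : p \oc g \oc f = p \oc h.
Proof. by rewrite -compA e. Qed.

Lemma iso_epi (x y z : C) (i : iso x y) (f g : hom y z) :
  f \oc i = g \oc i -> f = g.
Proof.
move=> e; rewrite -[f]compm1 -[g]compm1 -(iso_invK i).
by rewrite !compA e.
Qed.

Lemma iso_mono (x y z : C) (i : iso y z) (f g : hom x y) :
  iso_hom i \oc f = iso_hom i \oc g -> f = g.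
Proof.
move=> e; rewrite -[f]comp1m -[g]comp1m -(iso_homK i).
by rewrite -!compA e.
Qed.

End Linear.

(** * Coherence of the unit constraints *)

Section Coherence.
Variables (k : fieldType) (C : monCat k).

Lemma tensmMl (x y z t : C) (g : hom y z) (f : hom x y) :
  (g \oc f) \otm idm t = (g \otm idm t) \oc (f \otm idm t).
Proof. by rewrite -tensmM comp1m. Qed.

Lemma tensmMr (x y z t : C) (g : hom y z) (f : hom x y) :
  idm t \otm (g \oc f) = (idm t \otm g) \oc (idm t \otm f).
Proof. by rewrite -tensmM comp1m. Qed.

Lemma tensm_swap (x x' y y' : C) (f : hom x x') (g : hom y y') :
  (idm x' \otm g) \oc (f \otm idm y) = (f \otm idm y') \oc (idm x \otm g).
Proof. by rewrite -!tensmM !comp1m !compm1. Qed.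

Lemma one_tensm_inj (x y : C) (f g : hom x y) :
  idm one \otm f = idm one \otm g -> f = g.
Proof. by move=> e; apply: (@iso_epi _ _ _ _ _ (lunit x)); rewrite !lunit_nat e. Qed.

Lemma tensm_one_inj (x y : C) (f g : hom x y) :
  f \otm idm one = g \otm idm one -> f = g.
Proof. by move=> e; apply: (@iso_epi _ _ _ _ _ (runit x)); rewrite !runit_nat e. Qed.

Lemma tensl_isoK (x y z : C) (i : iso x y) :
  (i \otm idm z) \oc (iso_inv i \otm idm z) = idm (y \ot z).
Proof. by rewrite -tensmMl iso_invK tensm1. Qed.

(** Kelly's argument: after tensoring with [one] on the left, which is
    faithful, this is the pentagon at [one, one, x, y] with the triangle
    identity applied on both sides. *)
Lemma lunit_tens (x y : C) :
  lunit (x \ot y) \oc assoc one x y = lunit x \otm idm y.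
Proof.
apply: one_tensm_inj; apply: (@iso_epi _ _ _ _ _ (assoc one (one \ot x) y)).
have cancel_a (f g : hom ((one \ot (one \ot x)) \ot y) (one \ot (x \ot y))) :
    f \oc (assoc one one x \otm idm y) = g \oc (assoc one one x \otm idm y) ->
    f = g.
  move=> e; rewrite -[f]compm1 -[g]compm1 -(tensl_isoK _ (assoc one one x)).
  by rewrite !compA e.
apply: cancel_a.
rewrite tensmMr -!compA (compA _ (assoc _ _ _)) -pentagon !compA.
rewrite triangle -tensm1 assoc_nat assoc_nat -triangle.
by rewrite tensmMl !compA.
Qed.

(** The mirror image of [lunit_tens], from the pentagon at
    [x, y, one, one]. *)
Lemma runit_tens (x y : C) :
  (idm x \otm runit y) \oc assoc x y one = runit (x \ot y).
Proof.
apply: tensm_one_inj; apply: (@iso_mono _ _ _ _ _ (assoc x y one)).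
rewrite tensmMl compA -assoc_nat -triangle tensmMr.
rewrite -(triangle (x \ot y)) -tensm1 compA -assoc_nat.
by rewrite -!compA pentagon !compA.
Qed.

(** By [lunit_tens] and the triangle identity, both sides become
    [lunit (one \ot one)] and [idm one \otm lunit one] after tensoring with
    [one]; these agree by naturality of [lunit] at [lunit one]. *)
Lemma lunit_one : iso_hom (lunit one) = runit (one : C).
Proof.
apply: tensm_one_inj; rewrite -lunit_tens -triangle; congr (_ \oc _).
by apply: (@iso_mono _ _ _ _ _ (lunit one)); rewrite lunit_nat.
Qed.

(** One snake identity implies the other one as seen through the evaluation.
    Composing the snake of [xd] with [ev] leaves two copies of [ev] acting on
    disjoint factors of [(xd \ot x) \ot (xd \ot x)].  By interchange the inner
    copy may act first, and together with [coev] it forms the snake of [x];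
    only the outer [ev] remains, with unit constraints that cancel because
    [lunit one = runit one]. *)
Lemma ev_snake (x xd : C) (ev : hom (xd \ot x) one) (coev : hom one (x \ot xd)) :
  runit x \oc (idm x \otm ev) \oc assoc x xd x \oc (coev \otm idm x)
    \oc iso_inv (lunit x) = idm x ->
  ev \oc ((lunit xd \oc (ev \otm idm xd) \oc iso_inv (assoc xd x xd)
       \oc (idm xd \otm coev) \oc iso_inv (runit xd)) \otm idm x) = ev.
Proof.
move=> snake.
(* [S] is the snake of [x] with its final unit constraint left out. *)
set S := (idm x \otm ev) \oc assoc x xd x \oc (coev \otm idm x)
    \oc iso_inv (lunit x).
have SE : S = iso_inv (runit x).
  apply: (@iso_mono _ _ _ _ _ (runit x)).
  by rewrite iso_invK -snake /S !compA.
have triangleV : assoc xd one x \oc (iso_inv (runit xd) \otm idm x) =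
    idm xd \otm iso_inv (lunit x).
  rewrite -[LHS]comp1m -tensm1 -(iso_homK (lunit x)) tensmMr.
  rewrite -!compA (compA _ (assoc _ _ _)) triangle tensl_isoK.
  by rewrite compm1.
have pentagonV : assoc xd x (xd \ot x) \oc assoc (xd \ot x) xd x
      \oc (iso_inv (assoc xd x xd) \otm idm x) =
    (idm xd \otm assoc x xd x) \oc assoc xd (x \ot xd) x.
  by rewrite pentagon -!compA tensl_isoK compm1.
have runitV : iso_inv (assoc xd x one) \oc (idm xd \otm iso_inv (runit x)) =
    iso_inv (runit (xd \ot x)).
  apply: (@iso_mono _ _ _ _ _ (runit (xd \ot x))).
  rewrite iso_invK -{1}runit_tens !compA (comp_at_end (iso_invK _)) compm1.
  by rewrite -tensmMr iso_invK tensm1.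
have slide : (idm (xd \ot x) \otm ev) \oc assoc (xd \ot x) xd x
    \oc (iso_inv (assoc xd x xd) \otm idm x)
    \oc ((idm xd \otm coev) \otm idm x)
    \oc (iso_inv (runit xd) \otm idm x) = iso_inv (runit (xd \ot x)).
  rewrite -runitV -SE; apply: (@iso_mono _ _ _ _ _ (assoc xd x one)).
  rewrite !compA iso_invK comp1m -tensm1 -assoc_nat.
  rewrite -(compA _ (assoc xd x _)) (comp_at_end pentagonV) !compA.
  rewrite (comp_at_end (esym (assoc_nat _ _ _))).
  by rewrite !compA (comp_at_end triangleV) /S !tensmMr.
rewrite !tensmMl -lunit_tens !compA lunit_nat.
rewrite (comp_at_end (esym (assoc_nat _ _ _))) !compA tensm1.
rewrite (comp_at_end (tensm_swap _ _)).
rewrite -!compA in slide *; rewrite slide lunit_one.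
by rewrite compA -runit_nat -compA iso_invK compm1.
Qed.

End Coherence.

(** * The internal hom as a lax module functor *)

Section InternalHom.
Variables (k : fieldType) (C : monCat k) (x0 : C) (G : linFunctor C C).
Variable eta : forall x : C, hom x (G (x \ot x0)).
Variable eps : forall y : C, hom (G y \ot x0) y.
Hypothesis eta_nat : forall x x' (f : hom x x'),
  fmap G (f \otm idm x0) \oc eta x = eta x' \oc f.
Hypothesis eps_nat : forall y y' (g : hom y y'),
  g \oc eps y = eps y' \oc (fmap G g \otm idm x0).
Hypothesis eps_eta : forall x, eps (x \ot x0) \oc (eta x \otm idm x0) = idm (x \ot x0).
Hypothesis eta_eps : forall y, fmap G (eps y) \oc eta (G y) = idm (G y).

(** The mate of [f : x -> G y] is [eps y \oc (f \otm idm x0)].  This is how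
    equations between morphisms into an internal hom are checked below. *)
Lemma mate_inj (x y : C) (f g : hom x (G y)) :
  eps y \oc (f \otm idm x0) = eps y \oc (g \otm idm x0) -> f = g.
Proof.
move=> e; rewrite -[f]comp1m -[g]comp1m -eta_eps -!compA -!eta_nat !compA.
by rewrite -!fmapM e.
Qed.

Definition hom_act (x y : C) : hom (x \ot G y) (G (x \ot y)) :=
  fmap G ((idm x \otm eps y) \oc assoc x (G y) x0) \oc eta (x \ot G y).

Lemma hom_act_mate (x y : C) :
  eps (x \ot y) \oc (hom_act x y \otm idm x0) =
  (idm x \otm eps y) \oc assoc x (G y) x0.
Proof. by rewrite tensmMl compA -eps_nat -compA eps_eta compm1. Qed.

Lemma hom_act_nat (x x' y y' : C) (f : hom x x') (g : hom y y') :
  fmap G (f \otm g) \oc hom_act x y = hom_act x' y' \oc (f \otm fmap G g).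
Proof.
apply: mate_inj.
(* [hom_act] is itself a composite; the explicit instances keep it folded, so
   that [hom_act_mate] applies. *)
rewrite (tensmMl x0 _ (hom_act x y)) (tensmMl x0 (hom_act x' y')) !compA -eps_nat.
rewrite (comp_at_end (hom_act_mate _ _)) hom_act_mate !compA.
rewrite (comp_at_end (esym (assoc_nat _ _ _))) !compA.
by rewrite -!tensmM compm1 comp1m eps_nat.
Qed.

(** On mates, this is the pentagon at [x, y, G z, x0]. *)
Lemma hom_act_assoc (x y z : C) :
  fmap G (assoc x y z) \oc hom_act (x \ot y) z =
  hom_act x (y \ot z) \oc (idm x \otm hom_act y z) \oc assoc x y (G z).
Proof.
apply: mate_inj.
rewrite (tensmMl x0 _ (hom_act (x \ot y) z)) (tensmMl x0 (_ \oc _)).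
rewrite (tensmMl x0 (hom_act x _)) !compA -eps_nat.
rewrite (comp_at_end (hom_act_mate _ _)) hom_act_mate !compA.
rewrite (comp_at_end (esym (assoc_nat _ _ _))) compA -tensmMr hom_act_mate.
rewrite -tensm1 -assoc_nat -compA pentagon tensmMr.
by rewrite !compA.
Qed.

(** On mates, this is [lunit_tens] at [G y, x0]. *)
Lemma hom_act_unit (y : C) : fmap G (lunit y) \oc hom_act one y = lunit (G y).
Proof.
apply: mate_inj; rewrite (tensmMl x0 _ (hom_act one y)) !compA -eps_nat.
rewrite (comp_at_end (hom_act_mate _ _)).
by rewrite compA -lunit_nat -compA lunit_tens.
Qed.

Definition hom_laxModFunctor : laxModFunctor C :=
  LaxModFunctor hom_act_nat hom_act_assoc hom_act_unit.

(** The coevaluation has to be an element of [x0 \ot G one] whose image in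
    [G (x0 \ot one)] is the mate of the coherence isomorphism
    [one \ot x0 -> x0 \ot one]: up to [hom_act_mate] this is the snake identity
    for [x0].  Inverting [hom_act x0 one] produces such an element. *)
Lemma internal_hom_left_dual :
  is_iso (hom_act x0 one) ->
  exists coev : hom one (x0 \ot G one), is_left_dual (eps one) coev.
Proof.
case=> h [_ actK].
exists (h \oc (fmap G (iso_inv (runit x0) \oc lunit x0) \oc eta one)).
set coev := _ \oc (_ \oc _).
have snake : runit x0 \oc (idm x0 \otm eps one) \oc assoc x0 (G one) x0
    \oc (coev \otm idm x0) \oc iso_inv (lunit x0) = idm x0.
  rewrite (comp_at_end (esym (hom_act_mate _ _))) !compA.
  rewrite (comp_at_end (esym (tensmMl _ _ _))).
  rewrite /coev (compA (hom_act _ _)) actK comp1m.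
  rewrite tensmMl !compA -(compA _ (eps _)) -eps_nat -!compA.
  by rewrite (compA (eps _)) eps_eta comp1m iso_invK compm1 iso_invK.
split=> //; apply: mate_inj; rewrite ev_snake //.
by rewrite tensm1 compm1.
Qed.

End InternalHom.

Theorem proposition9p38 (k : fieldType) (C : monCat k)
    (C_left_closed : left_closed C)
    (lax_is_strong : forall F : laxModFunctor C, is_strong F) :
  left_rigid C.
Proof.
move=> x0; have [G [eta [eps [eta_nat eps_nat eps_eta eta_eps]]]] := C_left_closed x0.
have [coev dual] := internal_hom_left_dual eta_nat eps_nat eps_eta eta_eps
  (lax_is_strong (hom_laxModFunctor eta_nat eps_nat eps_eta eta_eps) x0 one).
by exists (G one), (eps one), coev.
Qed.
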